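(* Let $R$ be a commutative Noetherian ring of prime characteristic $p$. Let $M$ be a right $R[x,f]$-module that is Noetherian as an $R$-module. Then there exists a non-negative integer $k$ such that $Mx^k = Mx^{k+1}$.
   Context: $f : R \to R$, $f(r)=r^p$, is the Frobenius homomorphism. The Frobenius skew polynomial ring $R[x,f]$ is freely generated as a left $R$-module by $(x^i)_{i\ge 0}$, with multiplication subject to $xr = r^p x$ for $r\in R$. A right $R[x,f]$-module is regarded as an $R$-module by restriction of scalars. For $t\ge 0$, $Mx^t := \{mx^t : m\in M\}$, which is an $R[x,f]$-submodule of $M$. *)

(* Defs.v *)
From HB Require Import structures.
From mathcomp Require Import all_boot all_algebra.
From mathcomp Require Import boolp classical_sets.

Set Implicit Arguments.
Unset Strict Implicit.
Unset Printing Implicit Defensive.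

Import GRing.Theory.
Local Open Scope classical_set_scope.
Local Open Scope ring_scope.

(* The Ore extension R[x; s] on the additive group of {poly R}: left
   coefficients, free left R-basis (x^i), and x * a = s a * x. *)
Definition skew_poly (R : nzRingType) (s : {rmorphism R -> R}) : Type :=
  {poly R}.

Section SkewPoly.
Variables (R : nzRingType) (s : {rmorphism R -> R}).
Implicit Types p q r : {poly R}.

(* Left multiplication by x: sum b_j x^j |-> sum s(b_j) x^(j+1). *)
Definition skew_shift q : {poly R} := map_poly s q * 'X.

(* (sum a_i x^i) * q = sum a_i (x^i * q). *)
Definition skew_mul p q : {poly R} :=
  \sum_(i < size p) p`_i *: iter i skew_shift q.

Lemma skew_shiftD : {morph skew_shift : p q / p + q}.
Proof. by move=> p q; rewrite /skew_shift rmorphD mulrDl. Qed.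

Lemma skew_shift0 : skew_shift 0 = 0.
Proof. by rewrite /skew_shift rmorph0 mul0r. Qed.

Lemma skew_shiftZ a q : skew_shift (a *: q) = s a *: skew_shift q.
Proof. by rewrite /skew_shift map_polyZ scalerAl. Qed.

Lemma iter_skew_shiftD i : {morph iter i skew_shift : p q / p + q}.
Proof. by move=> p q; elim: i => //= i ->; rewrite skew_shiftD. Qed.

Lemma skew_mulE n p q : (size p <= n)%N ->
  skew_mul p q = \sum_(i < n) p`_i *: iter i skew_shift q.
Proof.
move=> le_pn; rewrite /skew_mul.
rewrite (big_ord_widen n (fun i => p`_i *: iter i skew_shift q)) //.
rewrite big_mkcond; apply: eq_bigr => i _.
by case: ltnP => // /(nth_default 0) ->; rewrite scale0r.
Qed.

Lemma skew_mulDl : left_distributive skew_mul +%R.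
Proof.
move=> p q r; set n := maxn (size p) (size q).
rewrite !(@skew_mulE n) ?leq_maxl ?leq_maxr ?size_polyD // -big_split /=.
by apply: eq_bigr => i _; rewrite coefD scalerDl.
Qed.

Lemma skew_mulDr : right_distributive skew_mul +%R.
Proof.
move=> p q r; rewrite /skew_mul -big_split /=.
by apply: eq_bigr => i _; rewrite iter_skew_shiftD scalerDr.
Qed.

Lemma skew_mul0l q : skew_mul 0 q = 0.
Proof. by rewrite /skew_mul size_poly0 big_ord0. Qed.

Lemma skew_mulZl a p q : skew_mul (a *: p) q = a *: skew_mul p q.
Proof.
rewrite (@skew_mulE (size p)) ?size_scale_leq // /skew_mul scaler_sumr.
by apply: eq_bigr => i _; rewrite coefZ scalerA.
Qed.

Lemma skew_mul_shift p q : skew_mul (skew_shift p) q = skew_shift (skew_mul p q).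
Proof.
rewrite (@skew_mulE (size p).+1); last first.
  by rewrite (leq_trans (size_polyMleq _ _)) // size_polyX addn2 ltnS size_poly.
rewrite /skew_mul (big_morph _ skew_shiftD skew_shift0).
rewrite big_ord_recl coefMX /= scale0r add0r; apply: eq_bigr => i _.
by rewrite skew_shiftZ coefMX coef_map.
Qed.

Lemma skew_mulA : associative skew_mul.
Proof.
move=> p q r; rewrite {1}/skew_mul [skew_mul p q]/skew_mul.
rewrite (big_morph (skew_mul^~ r) (fun a b => skew_mulDl a b r) (skew_mul0l r)).
apply: eq_bigr => i _; rewrite skew_mulZl; congr (_ *: _).
by elim: (i : nat) => //= j ->; rewrite skew_mul_shift.
Qed.

Lemma skew_mul1p : left_id 1 skew_mul.
Proof.
by move=> p; rewrite /skew_mul size_poly1 big_ord1 /= coef1 scale1r.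
Qed.

Lemma skew_mulp1 : right_id 1 skew_mul.
Proof.
move=> p; rewrite /skew_mul -[RHS]coefK poly_def; apply: eq_bigr => i _.
congr (_ *: _); elim: (i : nat) => [|j IH] /=; first by rewrite expr0.
by rewrite IH /skew_shift map_polyXn -exprSr.
Qed.

HB.instance Definition _ := GRing.Zmodule.copy (skew_poly s) {poly R}.
HB.instance Definition _ := GRing.Zmodule_isNzRing.Build (skew_poly s)
  skew_mulA skew_mul1p skew_mulp1 skew_mulDl skew_mulDr (oner_neq0 {poly R}).

Definition skewC (a : R) : skew_poly s := a%:P.
Definition skewX : skew_poly s := 'X : {poly R}.

Lemma skew_mulCE a p : skewC a * (p : skew_poly s) = a *: p.
Proof.
rewrite [LHS](@skew_mulE 1) ?size_polyC ?leq_b1 //.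
by rewrite big_ord1 /= coefC.
Qed.

Lemma skew_mulXE p : skewX * (p : skew_poly s) = skew_shift p.
Proof.
rewrite [LHS](@skew_mulE 2) ?size_polyX //.
by rewrite big_ord_recl big_ord1 /= !coefX /= scale0r add0r scale1r.
Qed.

Lemma skewXnE n : skewX ^+ n = ('X^n : {poly R}).
Proof.
elim: n => [|n IH]; first by rewrite !expr0.
by rewrite exprS IH skew_mulXE /skew_shift map_polyXn -exprSr.
Qed.

Lemma skewX_comm a : skewX * skewC a = skewC (s a) * skewX.
Proof. by rewrite skew_mulXE skew_mulCE /skew_shift map_polyC mul_polyC. Qed.

Lemma skewC_is_zmod_morphism : zmod_morphism skewC.
Proof. exact: polyCB. Qed.

Lemma skewC_is_monoid_morphism : monoid_morphism skewC.
Proof. by split=> // a b; rewrite skew_mulCE /skewC polyCM mul_polyC. Qed.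

HB.instance Definition _ :=
  GRing.isZmodMorphism.Build R (skew_poly s) skewC skewC_is_zmod_morphism.
HB.instance Definition _ :=
  GRing.isMonoidMorphism.Build R (skew_poly s) skewC skewC_is_monoid_morphism.

Lemma skew_polyE (u : skew_poly s) :
  u = \sum_(i < size (u : {poly R})) skewC (u : {poly R})`_i * skewX ^+ i.
Proof.
rewrite -[LHS](coefK (u : {poly R})) poly_def.
by apply: eq_bigr => i _; rewrite skewXnE skew_mulCE.
Qed.

Lemma skew_poly_free n (a : 'I_n -> R) :
  \sum_(i < n) skewC (a i) * skewX ^+ i = 0 -> forall i, a i = 0.
Proof.
move=> a0 i; have: \sum_(j < n) a j *: 'X^j = 0 :> {poly R}.
  by rewrite -[RHS]a0; apply: eq_bigr => j _; rewrite skew_mulCE skewXnE.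
move/(congr1 (fun q : {poly R} => q`_i)); rewrite coef0 coef_sum (bigD1 i) //=.
rewrite coefZ coefXn eqxx mulr1 big1 ?addr0 // => j ji.
by rewrite coefZ coefXn eq_sym (negbTE ji : (j == i :> nat) = false) mulr0.
Qed.

End SkewPoly.

Definition noetherian_module (R : pzRingType) (V : lmodType R) : Prop :=
  forall N : nat -> set V,
    (forall n, GRing.submod_closed [in N n]) ->
    (forall n, N n `<=` N n.+1) ->
  exists n, forall m, (n <= m)%N -> N m = N n.

(* For commutative R, the submodules of R^o are the ideals of R. *)
Definition noetherian_ring (R : comNzRingType) : Prop :=
  noetherian_module R^o.

Section FrobeniusSkewPoly.
Variables (R : comNzRingType) (p : nat) (pcharRp : p \in [pchar R]).

Definition frob_skew_poly : nzRingType :=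
  skew_poly (pFrobenius_aut pcharRp).

Lemma frob_skewX_comm (a : R) :
  skewX _ * skewC _ a = skewC _ (a ^+ p) * skewX _ :> frob_skew_poly.
Proof. exact: skewX_comm. Qed.

(* A right R[x,f]-module is a left module over the converse ring, so m.u is
   (u : R[x,f]^c) *: m and (m.u).v = m.(u * v). *)
Variable M : lmodType (frob_skew_poly^c).

Definition ract (m : M) (u : frob_skew_poly) : M :=
  (u : frob_skew_poly^c) *: m.

Lemma ractM m u v : ract (ract m u) v = ract m (u * v).
Proof. by rewrite /ract scalerA. Qed.

(* M with scalars restricted along R -> R[x,f]. *)
Definition restrict_scalars : Type := M.
HB.instance Definition _ := GRing.Zmodule.on restrict_scalars.

Definition restrict_scale (a : R) (m : restrict_scalars) : restrict_scalars :=
  ract m (skewC _ a).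

Fact restrict_scaleA a b v :
  restrict_scale a (restrict_scale b v) = restrict_scale (a * b) v.
Proof. by rewrite /restrict_scale ractM -rmorphM mulrC. Qed.

Fact restrict_scale1 : left_id 1 restrict_scale.
Proof. by move=> v; rewrite /restrict_scale rmorph1; apply: scale1r. Qed.

Fact restrict_scaleDr : right_distributive restrict_scale +%R.
Proof. by move=> a u v; apply: scalerDr. Qed.

Fact restrict_scaleDl v : {morph restrict_scale^~ v : a b / a + b}.
Proof. by move=> a b; rewrite /restrict_scale rmorphD; apply: scalerDl. Qed.

HB.instance Definition _ := GRing.Zmodule_isLmodule.Build R restrict_scalars
  restrict_scaleA restrict_scale1 restrict_scaleDr restrict_scaleDl.

Definition Mxn (t : nat) : set M :=
  [set ract m (skewX _ ^+ t) | m in [set: M]].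

End FrobeniusSkewPoly.

Arguments Mxn {R p pcharRp} M t.

(* Main.v *)
(** Write V_n = M x^n and kappa(m) = m x, so that r kappa(m) = kappa(r^p m).
    The ideals I_n = (V_(n+1) : V_n) increase, hence are equal to some I for
    n >= n0.  If x lies in I, then x^2 V_n0 is contained in
    x kappa(V_n0) = kappa(x^p V_n0), hence in kappa(x^2 V_n0) and so, by
    iteration, in every V_n.  Let K be the radical of the ideal of those r that
    map V_n0 into every V_n; thus K contains I.  If K were proper, a maximal
    colon ideal P = (K : a) with a outside K would be a prime with a outside P
    and a P in K.  Then V_n0 modulo the intersection of the V_n has finite
    length at P, so some s outside P satisfies s V_n <= V_(n+1) with n >= n0,
    contradicting I <= K <= P.  Localization is avoided by a Noetherian
    induction on the submodules on which the chain (V_n) stabilizes up to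
    multiplication by elements outside P (Gabber's argument). *)
Require Import Defs.
From mathcomp Require Import all_boot all_algebra.
From mathcomp Require Import boolp classical_sets.
From mathcomp Require Import zify.
Import GRing.Theory.
Local Open Scope ring_scope.

(** * Submodules as plain sets, and maximal members of families of submodules *)

Definition submodule {R : pzRingType} {V : lmodType R} (A : set V) : Prop :=
  A 0 /\ forall a u v, A u -> A v -> A (a *: u + v).

Section Submodules.
Context {R : pzRingType} {V : lmodType R}.
Implicit Types (A B : set V) (u v : V).

Lemma submodule_closed A : submodule A -> GRing.submod_closed [in A].
Proof.
move=> [A0 AD]; split=> [|a u v]; first exact/mem_set.
by move=> /set_mem Au /set_mem Av; apply/mem_set/AD.
Qed.

Lemma submoduleD {A} u v : submodule A -> A u -> A v -> A (u + v).
Proof. by move=> [_ AD] Au Av; rewrite -[u]scale1r; apply: AD. Qed.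

Lemma submoduleZ {A} a u : submodule A -> A u -> A (a *: u).
Proof. by move=> [A0 AD] Au; rewrite -[_ *: _]addr0; apply: AD. Qed.

Lemma submoduleB {A} u v : submodule A -> A u -> A v -> A (u - v).
Proof.
by move=> sA Au Av; apply: submoduleD => //; rewrite -scaleN1r; apply: submoduleZ.
Qed.

Lemma submodule_addKr {A} u v : submodule A -> A u -> A (v + u) -> A v.
Proof. by move=> sA Au Avu; rewrite -(addrK u v); apply: submoduleB. Qed.

Definition add_line A v : set V := fun u => exists w c, A w /\ u = w + c *: v.

Lemma submodule_add_line A v : submodule A -> submodule (add_line A v).
Proof.
move=> sA; split; first by exists 0, 0; rewrite scale0r addr0; case: sA.
move=> a _ _ [w [c [Aw ->]]] [w' [c' [Aw' ->]]].
exists (a *: w + w'), (a * c + c'); split; first by case: sA => _; apply.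
by rewrite scalerDr scalerDl scalerA addrACA.
Qed.

Lemma sub_add_line A v u : A u -> add_line A v u.
Proof. by move=> Au; exists u, 0; rewrite scale0r addr0. Qed.

Lemma mem_add_line A v : submodule A -> add_line A v v.
Proof. by move=> [A0 _]; exists 0, 1; rewrite scale1r add0r. Qed.

(** Without a maximal member, choice would turn [A0] into a strictly increasing chain inside [F]. *)
Lemma noetherian_maximal (F : set (set V)) A0 :
  noetherian_module V -> (forall A, F A -> submodule A) -> F A0 ->
  exists2 A, F A & forall B, F B -> (forall u, A u -> B u) ->
    forall u, B u -> A u.
Proof.
move=> noethV Fsub FA0; apply: contrapT => nomax.
have grow (A : {A | F A}) : exists B : {B | F B},
    (forall u, sval A u -> sval B u) /\ exists2 u, sval B u & ~ sval A u.
  apply: contrapT => ngrow; apply: nomax.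
  exists (sval A); first exact: svalP A.
  move=> B FB AB u Bu; apply: contrapT => nAu; apply: ngrow.
  by exists (exist _ B FB); split=> //; exists u.
have [g gP] := choice grow.
pose N n := sval (iter n g (exist _ A0 FA0)).
have [|n u|n nP] := noethV N; first by move=> n; apply/submodule_closed/Fsub/svalP.
  by case: (gP (iter n g (exist _ A0 FA0))) => + _; apply.
have [_ [u Bu []]] := gP (iter n g (exist _ A0 FA0)).
by have := nP n.+1 (leqnSn n); rewrite /N /= => <-.
Qed.

End Submodules.

(** * Annihilator, radical and colon ideals *)

Section DescendingChains.
Context {R : comNzRingType} {M : lmodType R}.
Implicit Types (a b r s t : R) (u v w : M).

Lemma submodule_annihilator (A B : set M) : submodule B ->
  submodule (fun r : R^o => forall u, A u -> B (r *: u)).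
Proof.
move=> sB; split=> [u _|a r s rAB sAB u Au]; first by rewrite scale0r; case: sB.
by rewrite scalerDl -scalerA; apply: submoduleD => //;
  [apply: submoduleZ => //; apply: rAB|apply: sAB].
Qed.

Lemma submodule_radical (L : set R^o) : submodule L ->
  submodule (fun r : R^o => exists e, L ((r : R) ^+ e)).
Proof.
move=> sL; split; first by exists 1%N; rewrite expr1; case: sL.
move=> a r s [d Lr] [e Ls]; exists (d + e)%N.
have LM (x y : R) : L y -> L (x * y) by apply: (@submoduleZ R R^o _ x y sL).
(* In each binomial term either [s] has exponent at least [e] or [a *: r] has exponent at least
   [d]. *)
rewrite exprDn; apply: (big_ind L); first by case: sL.
  by move=> x y Lx Ly; apply: submoduleD.
move=> i _; rewrite -mulr_natl; apply/LM.
case: (leqP e i) => [le_ei|lt_ie].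
  by rewrite -(subnK le_ei) exprD mulrA; apply/LM.
have le_d : (d <= d + e - i)%N by lia.
rewrite mulrC; apply/LM; rewrite -(subnK le_d) exprD; apply/LM.
by rewrite -[a *: r]/(a * r) exprMn; apply/LM.
Qed.

(* [P := (K : a)] maximal among the colon ideals with [a] outside [K]; as [K]
   is radical, [a] itself is outside [P]. *)
Lemma radical_colon_prime (K : set R^o) : noetherian_ring R ->
  submodule K -> (forall r e, K ((r : R) ^+ e) -> K r) -> ~ K (1 : R) ->
  exists (P : set R) (a : R),
    [/\ forall r s, ~ P r -> ~ P s -> ~ P (r * s), ~ P 1, ~ P a,
        forall r, K r -> P r & forall r, P r -> K (a * r : R)].
Proof.
move=> noethR sK radK K1.
pose colon a : set R^o := fun r => K (a * r).
pose F (A : set R^o) := exists2 a : R, ~ K a & A = colon a.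
have KM (x y : R) : K y -> K (x * y : R) by apply: (@submoduleZ R R^o _ x y sK).
have [||_ [a Ka ->] maxa] := @noetherian_maximal _ R^o F (colon 1) noethR.
- move=> _ [a _ ->]; split; first by rewrite /colon mulr0; case: sK.
  move=> b r s; rewrite /colon mulrDr => Kr Ks.
  by rewrite -[b *: r]/(b * r) mulrCA; case: sK => _; apply.
- by exists 1.
exists (colon a), a; split=> //.
- move=> r s nr ns nrs; apply: ns.
  (* As [a * r] is outside [K], maximality forces [colon (a * r)], which contains [s], back into
     [colon a]. *)
  apply: (maxa (colon (a * r))); first by exists (a * r).
    by move=> x; rewrite /colon mulrAC [_ * r]mulrC; apply/KM.
  by rewrite /colon -mulrA.
- by rewrite /colon mulr1.
- by rewrite /colon => Kaa; apply: Ka; apply: (radK a 2%N); rewrite expr2.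
- by move=> r; apply/KM.
Qed.

(** * Stabilization of a chain up to multipliers outside a prime *)

Section UpToPrime.
Variables (P : set R) (V : nat -> set M).
Hypothesis PM : forall r s, ~ P r -> ~ P s -> ~ P (r * s).
Hypothesis P1 : ~ P 1.
Hypothesis sV : forall n, submodule (V n).
Hypothesis VS : forall n u, V n.+1 u -> V n u.

(** Replaces stationarity of the traces of [V n] on [N] after localizing at [P], with one
    denominator [s] for each [n]. *)
Definition eventually_stable_on (N : set M) : Prop :=
  exists n0, forall n, (n0 <= n)%N ->
    exists2 s, ~ P s & forall u, V n u -> N u -> V n.+1 (s *: u).

Lemma chain_anti m n u : (m <= n)%N -> V n u -> V m u.
Proof.
move=> /subnK <-; elim: (n - m)%N => // k IH; rewrite addSn => /VS; exact: IH.
Qed.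

Lemma expr_notin r e : ~ P r -> ~ P (r ^+ e).
Proof. by move=> Pr; elim: e => [|e IH]; rewrite ?expr0 // exprS; apply: PM. Qed.

Lemma eventually_stable_torsion N v s : ~ P s -> submodule N -> N (s *: v) ->
  eventually_stable_on N -> eventually_stable_on (add_line N v).
Proof.
move=> Ps sN Nsv [n0 n0P]; exists n0 => n /n0P [t Pt tP].
exists (t * s); first exact: PM.
move=> u Vu [w [c [Nw def_u]]]; rewrite -scalerA; apply: tP.
  exact: submoduleZ.
rewrite def_u scalerDr scalerA mulrC -scalerA.
by apply: submoduleD => //; apply: submoduleZ.
Qed.

(* Here [add_line N v] modulo [N] is a copy of the domain R/P: each [V n] meets
   it either in a full rank ideal or in 0. *)
Lemma eventually_stable_prime N v : submodule N -> (forall r, P r -> N (r *: v)) ->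
  eventually_stable_on N -> eventually_stable_on (add_line N v).
Proof.
move=> sN Pv [n0 n0P].
pose colon n r := exists2 w, V n w & N (r *: v - w).
have [full|nfull] := pselect (forall n, exists2 r, ~ P r & colon n r).
  exists n0 => n /n0P [t Pt tP].
  have [r Pr [w Vw Nrvw]] := full n.+1.
  exists (t * r) => [|u Vu [y [c [Ny def_u]]]]; first exact: PM.
  (* Since [r *: v] is [w] modulo [N], the element [r *: u - c *: w] lies in both [V n] and [N], so
     [t] sends it into [V n.+1]. *)
  rewrite -scalerA; apply: (@submodule_addKr _ _ _ (- (t *: (c *: w)))) => //.
    by rewrite -scaleN1r; do 3![apply: submoduleZ => //].
  rewrite -scalerBr; apply: tP.
    by apply: submoduleB => //; apply: submoduleZ => //; exact: VS.
  rewrite def_u scalerDr -addrA; apply: submoduleD => //; first exact: submoduleZ.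
  by rewrite scalerA mulrC -scalerA -scalerBr; apply: submoduleZ.
have [n1 n1P] : exists n1, forall r, colon n1 r -> P r.
  apply: contrapT => nn1; apply: nfull => n; apply: contrapT => nr.
  by apply: nn1; exists n => r colr; apply: contrapT => Pr; apply: nr; exists r.
exists (maxn n0 n1) => n; rewrite geq_max => /andP[/n0P [t Pt tP] le_n1n].
exists t => // u Vu [y [c [Ny def_u]]]; apply: tP => //.
(* Here [u] itself shows that [c] is in [colon n1], hence in [P], so [c *: v] and [u] are in [N]. *)
rewrite def_u; apply: submoduleD => //; apply/Pv/n1P.
exists u; first exact: chain_anti Vu.
rewrite def_u opprD addrCA subrr addr0 -scaleN1r.
exact: submoduleZ.
Qed.

(** A maximal stable [N] containing the intersection of the chain must contain [V 0]: otherwise some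
    [v] in [V 0] outside [N], with maximal annihilator modulo [N], is killed by [P] modulo [N] and
    could be adjoined. *)
Lemma eventually_stable_top a : noetherian_ring R -> noetherian_module M ->
  ~ P a ->
  (forall r, P r -> exists e, forall n u, V 0 u -> V n ((a * r) ^+ e *: u)) ->
  exists n s, ~ P s /\ forall u, V n u -> V n.+1 (s *: u).
Proof.
move=> noethR noethM Pa nilP.
pose F N := [/\ submodule N, eventually_stable_on N
                & forall u, (forall n, V n u) -> N u].
have [||N [sN stN capN] maxN] :=
    @noetherian_maximal _ M F (fun u => forall n, V n u) noethM.
- by move=> N [].
- split=> //; first split=> [n|b u v Vu Vv n].
  + by case: (sV n).
  + by apply: submoduleD => //; apply: submoduleZ.
  + exists 0%N => n _; exists 1 => // u _ Vu.
    by rewrite scale1r.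
have extN v : eventually_stable_on (add_line N v) -> N v.
  move=> stNv; apply: (maxN (add_line N v)).
  - split=> //; first exact: submodule_add_line.
    by move=> u Vu; apply/sub_add_line/capN.
  - by move=> u; apply: sub_add_line.
  - exact: mem_add_line.
have satN v s : ~ P s -> N (s *: v) -> N v.
  by move=> Ps Nsv; apply: extN; apply: eventually_stable_torsion Nsv stN.
have [V0N|V0N] := pselect (forall u, V 0 u -> N u).
  case: stN => n0 n0P; have [s Ps sP] := n0P n0 (leqnn _).
  exists n0, s; split=> // u Vu; apply: sP => //.
  exact: V0N (chain_anti _ _ _ (leq0n n0) Vu).
have [v0 V0v0 Nv0] : exists2 v, V 0 v & ~ N v.
  apply: contrapT => nv; apply: V0N => u Vu; apply: contrapT => Nu.
  by apply: nv; exists u.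
pose ann v : set R^o := fun r => N ((r : R) *: v).
pose G A := exists v, [/\ V 0 v, ~ N v & A = ann v].
have [||_ [v [V0v Nv ->]] maxv] := @noetherian_maximal _ R^o G (ann v0) noethR.
- move=> _ [v [_ _ ->]]; split; first by rewrite /ann scale0r; case: sN.
  move=> b r s; rewrite /ann scalerDl -scalerA => Nr Ns.
  by apply: submoduleD => //; apply: submoduleZ.
- by exists v0.
case: Nv; apply: extN; apply: eventually_stable_prime => // r Pr.
have [e eP] := nilP r Pr.
have {eP} : N (r ^+ e *: v).
  apply: (satN _ (a ^+ e)); first exact: expr_notin.
  by rewrite scalerA -exprMn; apply: capN => n; apply: eP.
(* If [r ^+ e *: v] is outside [N], its annihilator modulo [N] contains [r] and, by maximality, is
   no larger than that of [v]. *)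
elim: e => [|e IH]; first by rewrite expr0 scale1r; apply: submoduleZ.
move=> Nre; have [/IH //|nN] := pselect (N (r ^+ e *: v)).
apply: (maxv (ann (r ^+ e *: v))).
- by exists (r ^+ e *: v); split=> //; apply: submoduleZ.
- by move=> x Nx; rewrite /ann scalerA mulrC -scalerA; apply: submoduleZ.
- by rewrite /ann scalerA -exprS.
Qed.

End UpToPrime.

Lemma chain_stationary (V : nat -> set M) :
  noetherian_ring R -> noetherian_module M ->
  (forall n, submodule (V n)) -> (forall n u, V n.+1 u -> V n u) ->
  (forall n s, (forall u, V n u -> V n.+1 (s *: u)) ->
     exists e, forall m u, V 0 u -> V m (s ^+ e *: u)) ->
  exists n, forall u, V n u -> V n.+1 u.
Proof.
move=> noethR noethM sV VS nilV.
pose L : set R^o := fun r => forall u, V 0 u -> forall n, V n ((r : R) *: u).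
pose K : set R^o := fun r => exists e, L ((r : R) ^+ e).
have sL : submodule L.
  apply: (submodule_annihilator (V 0) (fun u => forall n, V n u)).
  split=> [n|a u v Vu Vv n]; first by case: (sV n).
  by apply: submoduleD => //; apply: submoduleZ.
have [[e K1]|K1] := pselect (K (1 : R)).
  by exists 0%N => u /K1 /(_ 1%N); rewrite expr1n scale1r.
have [|P [a [PM P1 Pa KP PK]]] :=
    radical_colon_prime K noethR (submodule_radical L sL) _ K1.
  by move=> r e [d Ld]; exists (e * d)%N; rewrite exprM.
have [|n [s [Ps sP]]] :=
    eventually_stable_top P V PM P1 sV VS a noethR noethM Pa.
  by move=> r /PK [e eL]; exists e => n u /eL.
case: Ps; apply: KP; have [e eP] := nilV n s sP.
by exists e => u Vu m; apply: eP.
Qed.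

End DescendingChains.

(** * Iterated images of an additive map that is linear up to p-th roots of scalars *)

Section Cartier.
Context {R : comNzRingType} {M : lmodType R}.
Variables (p : nat) (kappa : M -> M).
Hypothesis p_gt1 : (1 < p)%N.
Hypothesis kappaD : {morph kappa : u v / u + v}.
Hypothesis kappaZ : forall r u, r *: kappa u = kappa (r ^+ p *: u).

Definition iter_image n : set M := fun u => exists v, u = iter n kappa v.

Lemma iter_imageS n u : iter_image n.+1 u <-> exists2 v, iter_image n v & u = kappa v.
Proof.
split=> [[v ->]|[_ [v ->] ->]]; last by exists v.
by exists (iter n kappa v) => //; exists v.
Qed.

Lemma iter_image_anti n u : iter_image n.+1 u -> iter_image n u.
Proof. by move=> [v ->]; exists (kappa v); rewrite -iterSr. Qed.

Lemma submodule_iter_image n : submodule (iter_image n).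
Proof.
elim: n => [|n [I0 ID]]; first by split=> [|a u v _ _]; [exists 0|eexists].
have kappa0 : kappa 0 = 0 by have := kappaZ 0 0; rewrite scale0r scaler0.
split=> [|a u v /iter_imageS[u' Iu ->] /iter_imageS[v' Iv ->]].
  by apply/iter_imageS; exists 0.
apply/iter_imageS; exists (a ^+ p *: u' + v'); first exact: ID.
by rewrite kappaD kappaZ.
Qed.

(** Makes the colon ideals increase: [r *: kappa u] is [kappa] of [r ^+ p.-1 *: (r *: u)]. *)
Lemma iter_image_annS n r : (forall u, iter_image n u -> iter_image n.+1 (r *: u)) ->
  forall u, iter_image n.+1 u -> iter_image n.+2 (r *: u).
Proof.
move=> rP _ /iter_imageS[u Iu ->]; rewrite kappaZ; apply/iter_imageS.
exists (r ^+ p *: u) => //; rewrite -(prednK (ltnW p_gt1)) exprSr -scalerA.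
by apply: submoduleZ; [apply: submodule_iter_image|apply: rP].
Qed.

(* [r^2 V <= r kappa(V) = kappa(r^p V) <= kappa(r^2 V)], since [p >= 2]. *)
Lemma iter_image_sqr n r : (forall u, iter_image n u -> iter_image n.+1 (r *: u)) ->
  forall m u, iter_image n u -> iter_image (m + n) (r ^+ 2 *: u).
Proof.
move=> rP; elim=> [|m IH] u Iu.
  by apply: submoduleZ => //; apply: submodule_iter_image.
rewrite expr2 -scalerA; have /iter_imageS[v Iv ->] := rP u Iu.
rewrite kappaZ addSn; apply/iter_imageS; exists (r ^+ p *: v) => //.
rewrite -(subnKC p_gt1) exprD -scalerA; apply: IH.
by apply: submoduleZ => //; apply: submodule_iter_image.
Qed.

Lemma iter_image_stationary : noetherian_ring R -> noetherian_module M ->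
  exists n, forall u, iter_image n u -> iter_image n.+1 u.
Proof.
move=> noethR noethM.
pose I n : set R^o := fun r => forall u, iter_image n u ->
  iter_image n.+1 ((r : R) *: u).
have [||n0 n0P] := noethR I.
- by move=> n; apply/submodule_closed/submodule_annihilator/submodule_iter_image.
- by move=> n r; apply: iter_image_annS.
(* Starting the chain at [n0] makes the colon ideals constant, so a multiplier at any later stage
   already works at [n0], where its square reaches every stage. *)
have [|||n nP] := chain_stationary (fun n => iter_image (n + n0)) noethR noethM.
- by move=> n; apply: submodule_iter_image.
- by move=> n u; apply: iter_image_anti.
- move=> n s sP; exists 2%N => m u; apply: iter_image_sqr.
  have := n0P (n + n0)%N (leq_addl _ _); rewrite /I => /(congr1 (fun A => A s)).
  by move=> <-.
by exists (n + n0)%N.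
Qed.

End Cartier.

Theorem theorem3p4 (R : comNzRingType) (p : nat) (pcharRp : p \in [pchar R])
    (noethR : noetherian_ring R)
    (M : lmodType ((frob_skew_poly pcharRp)^c))
    (noethM : noetherian_module (restrict_scalars M)) :
  exists k : nat, Mxn M k = Mxn M k.+1.
Proof.
pose kappa (m : restrict_scalars M) : restrict_scalars M :=
  ract m (skewX (pFrobenius_aut pcharRp)).
have kappaD : {morph kappa : u v / u + v} by move=> u v; apply: (@scalerDr _ M).
(* This is [x r = r^p x] read on the right: [(m x) r = (m r^p) x]. *)
have kappaZ r u : r *: kappa u = kappa (r ^+ p *: u).
  by rewrite /kappa /GRing.scale /= /restrict_scale !ractM frob_skewX_comm.
have iterE n m : iter n kappa m = ract m (skewX (pFrobenius_aut pcharRp) ^+ n).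
  elim: n => [|n IH]; first by rewrite expr0 /ract scale1r.
  by rewrite iterS IH /kappa ractM exprSr.
have MxnE n u : Mxn M n u <-> iter_image kappa n u.
  by split=> [[m _ <-]|[m ->]]; exists m => //; rewrite iterE.
have p_gt1 : (1 < p)%N by apply/prime_gt1/(pcharf_prime pcharRp).
have [n nP] := iter_image_stationary p kappa p_gt1 kappaD kappaZ noethR noethM.
exists n; apply/seteqP; split=> u /MxnE Iu; apply/MxnE; first exact: nP.
exact: iter_image_anti.
Qed.
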